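(* Let $T\ge 1$ be an integer and run proximal SGD from a deterministic point $x_0\in\mathbb{R}^n$ with constant step size $\tau = \frac{1}{3L\sqrt{T}}$, i.e. $x_{t+1}=\operatorname{prox}_{\tau g}(x_t-\tau\nabla f_{i_t}(x_t))$ for $t=0,1,\dots,T$. Then \[ \mathbb{E}\left[h(x_{T+1})-h^*\right]\le \frac{9}{\sqrt{T}}\left[L D_*^2+\frac{1}{\sqrt{T}}\bigl(h(x_0)-h^*\bigr)+\frac{\sigma_*^2}{L}\Bigl(\frac{1}{T}+4\ln(T+1)\Bigr)\right]. \]
   Context: Setting. Let $D$ be a probability distribution on an index set, and for each index $i$ let $f_i:\mathbb{R}^n\to\mathbb{R}$ be convex and differentiable with $L$-Lipschitz gradient ($L>0$). Let $f(x)=\mathbb{E}_{i\sim D}[f_i(x)]$, with $\mathbb{E}_{i\sim D}[\nabla f_i(x)]=\nabla f(x)$ for all $x$. Let $g:\mathbb{R}^n\to\mathbb{R}\cup\{+\infty\}$ be proper, convex and lower semicontinuous, and $h=f+g$. Assume the solution set $X^*=\arg\min_x h(x)$ is nonempty, write $h^*=\min h$, $D_*^2=\min_{x^*\in X^*}\|x^*-x_0\|^2$, and assume $\sigma_*^2:=\mathbb{E}_{i\sim D}\|\nabla f_i(x^* )\|^2<\infty$ for some $x^*\in X^*$. For $\tau>0$, $\operatorname{prox}_{\tau g}(y)=\arg\min_z\{\tau g(z)+\tfrac12\|y-z\|^2\}$. The indices $i_0,i_1,\dots$ are drawn i.i.d. from $D$, with $i_t$ independent of $x_0,\dots,x_t$.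 *)

(* Defs.v *)
From HB Require Import structures.
From mathcomp Require Import all_boot all_order all_algebra.
From mathcomp Require Import all_classical all_reals all_analysis.
Set Implicit Arguments. Unset Strict Implicit. Unset Printing Implicit Defensive.
Import Order.TTheory GRing.Theory Num.Theory.
Import numFieldNormedType.Exports.
Local Open Scope classical_set_scope.
Local Open Scope ring_scope.

Definition sqnorm (R : realType) (n : nat) (v : 'rV[R]_n) : R :=
  \sum_(j < n) v 0 j ^+ 2.
Definition enorm (R : realType) (n : nat) (v : 'rV[R]_n) : R :=
  Num.sqrt (sqnorm v).

Definition grad (R : realType) (n : nat) (F : 'rV[R]_n -> R) (x : 'rV[R]_n)
  : 'rV[R]_n := \row_(j < n) ('d F x (delta_mx 0 j)).

Definition convex_fun (R : realType) (n : nat) (F : 'rV[R]_n -> R) : Prop :=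
  forall (x y : 'rV[R]_n) (t : R), 0 <= t <= 1 ->
    F (t *: x + (1 - t) *: y) <= t * F x + (1 - t) * F y.

Definition convex_efun (R : realType) (n : nat) (G : 'rV[R]_n -> \bar R) : Prop :=
  forall (x y : 'rV[R]_n) (t : R), 0 <= t <= 1 ->
    (G (t *: x + (1 - t) *: y)%R <= t%:E * G x + (1 - t)%:E * G y)%E.

Definition proper_efun (R : realType) (n : nat) (G : 'rV[R]_n -> \bar R) : Prop :=
  (forall x, G x != -oo%E) /\ (exists x, (G x < +oo)%E).

Definition is_prox (R : realType) (n : nat) (tau : R) (G : 'rV[R]_n -> \bar R)
  (y z : 'rV[R]_n) : Prop :=
  forall w, (tau%:E * G z + (2^-1 * sqnorm (y - z))%R%:E
             <= tau%:E * G w + (2^-1 * sqnorm (y - w))%R%:E)%E.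

Definition argmin_set (R : realType) (n : nat) (H : 'rV[R]_n -> \bar R)
  : set 'rV[R]_n := [set x | forall y, (H x <= H y)%E].

(* Expectation over i.i.d. indices i_0, ..., i_{k-1} ~ P of F [:: i_0; ...; i_{k-1}],
   as the iterated integral (i_0 outermost). *)
Fixpoint Eiter (d : measure_display) (I : measurableType d) (R : realType)
  (P : probability I R) (k : nat) (F : seq I -> \bar R) : \bar R :=
  match k with
  | 0 => F [::]
  | k'.+1 => (\int[P]_i Eiter P k' (fun s => F (i :: s)))%E
  end.

(* Main.v *)
Require Import Defs.
From HB Require Import structures.
From mathcomp Require Import all_boot all_order all_algebra.
From mathcomp Require Import all_classical all_reals all_analysis.
From mathcomp Require Import measurable_realfun ring lra.
Import Order.TTheory GRing.Theory Num.Theory.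
Import numFieldNormedType.Exports.
Local Open Scope classical_set_scope.
Local Open Scope ring_scope.

(** With [gap x = h x - h*] and any reference point [z], the prox inequality, the descent
lemma and cocoercivity of the gradients give, for one step,
[E (gap x+ + |x+ - z|^2 / (2 tau)) <= gap z + |x - z|^2 / (2 tau) + a gap x + b]
with [a = 3 tau L = 1 / sqrt T] and [b = 3/2 tau sigma^2]. To reach the last iterate, [z]
is replaced at each step by a convex combination of itself and the current iterate, and a
potential combining [|x - z|^2], [gap z] and [gap x] decreases in mean. Its coefficients are
driven by [growth a k = prod_(j < k) (1 + a / j.+1)], which stays below 6 up to [k = T].

The right-hand side of the one-step inequality is, before averaging, an explicit integrable
function of the index. Hence nothing needs to be known about the measurability of the
iterates: the integral of a nonnegative function is monotone without it. *)

(** * Inner product *)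

Definition dot {R : realType} {n : nat} (u v : 'rV[R]_n) : R :=
  \sum_(j < n) u 0 j * v 0 j.

Section InnerProduct.
Context {R : realType} {n : nat}.
Implicit Types (u v w : 'rV[R]_n) (k : R).

Lemma dotC u v : dot u v = dot v u.
Proof. by apply: eq_bigr => j _; rewrite mulrC. Qed.

Lemma dotDl u v w : dot (u + v) w = dot u w + dot v w.
Proof. by rewrite -big_split; apply: eq_bigr => j _; rewrite !mxE mulrDl. Qed.

Lemma dotZl k u v : dot (k *: u) v = k * dot u v.
Proof. by rewrite /dot mulr_sumr; apply: eq_bigr => j _; rewrite !mxE mulrA. Qed.

Lemma dotNl u v : dot (- u) v = - dot u v.
Proof. by rewrite -scaleN1r dotZl mulN1r. Qed.

Lemma dotDr u v w : dot w (u + v) = dot w u + dot w v.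
Proof. by rewrite dotC dotDl !(dotC w). Qed.

Lemma dotZr k u v : dot u (k *: v) = k * dot u v.
Proof. by rewrite dotC dotZl dotC. Qed.

Lemma dotNr v u : dot u (- v) = - dot u v.
Proof. by rewrite dotC dotNl dotC. Qed.

Definition dotE := (dotDl, dotDr, dotNl, dotNr, dotZl, dotZr).

Lemma sqnormE u : sqnorm u = dot u u.
Proof. by apply: eq_bigr => j _; rewrite expr2. Qed.

Lemma sqnorm_ge0 u : 0 <= sqnorm u.
Proof. by apply: sumr_ge0 => j _; rewrite sqr_ge0. Qed.

Lemma sqnormZ k u : sqnorm (k *: u) = k ^+ 2 * sqnorm u.
Proof. by rewrite !sqnormE !dotE mulrA. Qed.

Lemma sqnormN u : sqnorm (- u) = sqnorm u.
Proof. by rewrite -scaleN1r sqnormZ sqrrN expr1n mul1r. Qed.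

Lemma sqnormB u v : sqnorm (u - v) = sqnorm u - 2 * dot u v + sqnorm v.
Proof. by rewrite !sqnormE !dotE (dotC v u); ring. Qed.

Lemma sqnormBC u v : sqnorm (u - v) = sqnorm (v - u).
Proof. by rewrite -sqnormN opprB. Qed.

Lemma dot_young k u v : 0 < k -> 2 * dot u v <= k * sqnorm u + k^-1 * sqnorm v.
Proof.
move=> k0; have := sqnorm_ge0 (k *: u - v).
rewrite sqnormB dotZl sqnormZ => h.
rewrite -(ler_pM2l k0) mulrDr !mulrA divff ?gt_eqF// mul1r.
by move: h; lra.
Qed.

(** The difference of the two sides is the squared norm of [u - v - v]. *)
Lemma sqnorm_le2 u v : sqnorm u <= 2 * sqnorm (u - v) + 2 * sqnorm v.
Proof.
have := sqnorm_ge0 (u - v - v).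
have -> : u = (u - v) + v by rewrite subrK.
move: (u - v) => w; rewrite addrK sqnormB !sqnormE !dotE (dotC v w); lra.
Qed.

(** Young's inequality with parameter [k^-1] does the work of Cauchy-Schwarz; at [k = 0] the
    parameter degenerates, but then [u] vanishes. *)
Lemma dot_le_lipschitz (k : R) u v :
  0 <= k -> enorm u <= k * enorm v -> dot u v <= k * sqnorm v.
Proof.
move=> k0 uv.
have uv2 : sqnorm u <= k ^+ 2 * sqnorm v.
  rewrite -(sqr_sqrtr (sqnorm_ge0 u)) -(sqr_sqrtr (sqnorm_ge0 v)) -exprMn.
  by rewrite ler_sqr ?nnegrE ?mulr_ge0 ?sqrtr_ge0.
have [k_eq0|kn0] := eqVneq k 0.
  have u0 : sqnorm u <= 0 by move: uv2; rewrite k_eq0 expr0n mul0r.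
  suff -> : dot u v = 0 by rewrite k_eq0 mul0r.
  apply: big1 => j _; suff -> : u 0 j = 0 by rewrite mul0r.
  have /eqP : sqnorm u = 0 by apply/eqP; rewrite eq_le u0 sqnorm_ge0.
  rewrite psumr_eq0 => [/allP /(_ j)|i _]; last exact: sqr_ge0.
  by rewrite mem_index_enum sqrf_eq0 => /(_ isT) /eqP.
have kp : 0 < k by rewrite lt_def kn0.
have := @dot_young k^-1 u v; rewrite invr_gt0 invrK => /(_ kp).
have : k^-1 * sqnorm u <= k * sqnorm v.
  by rewrite -(ler_pM2l kp) mulrA divff// mul1r mulrA -expr2.
lra.
Qed.

End InnerProduct.

(** * Smooth convex functions *)

Section SmoothConvex.
Context {R : realType} {n : nat}.
Variable F : 'rV[R]_n -> R.
Hypothesis dF : forall x, differentiable F x.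

Lemma diff_grad x v : 'd F x v = dot (grad F x) v.
Proof.
rewrite {1}(row_sum_delta v) linear_sum; apply: eq_bigr => j _.
by rewrite linearZ /= /grad mxE mulrC.
Qed.

Lemma is_derive_line x d (t : R) :
  is_derive t 1 (fun s : R => F (x + s *: d)) (dot (grad F (x + t *: d)) d).
Proof.
have := @diff_derivable _ _ _ _ _ d (dF (x + t *: d)).
have dE : (fun h : R => h^-1 *: ((F \o shift (x + t *: d)) (h *: d) - F (x + t *: d)))
  = (fun h : R => h^-1 *: (((fun s : R => F (x + s *: d)) \o shift t) (h *: 1)
                          - F (x + t *: d))).
  apply/funext => h /=; congr (_ *: (F _ - _)).
  by rewrite scalerDl addrCA [_ *: 1]mulr1.
have := deriveE d (dF (x + t *: d)); rewrite diff_grad /derivable /derive dE.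
by move=> <- dr; split.
Qed.

Section Descent.
Variable L : R.
Hypothesis L0 : 0 <= L.
Hypothesis lipF : forall x y, enorm (grad F x - grad F y) <= L * enorm (x - y).

(** Along the segment, [phi] is [F] minus its tangent at [x] and minus the quadratic term. The
    Lipschitz bound makes [dphi] nonpositive on (0, 1), so [phi 1 <= phi 0] by the mean value
    theorem. *)
Lemma descent_lemma x y :
  F y <= F x + dot (grad F x) (y - x) + L / 2 * sqnorm (y - x).
Proof.
pose d := y - x.
pose phi := (fun s : R => F (x + s *: d)) - (fun s : R => s * dot (grad F x) d)
  - (fun s : R => L / 2 * sqnorm d * s ^+ 2).
pose dphi (s : R) := dot (grad F (x + s *: d)) d - dot (grad F x) d - L * sqnorm d * s.
have phiD (s : R) : is_derive s 1 phi (dphi s).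
  have D1 := is_derive_line x d s.
  have D2 : is_derive s 1 (fun s : R => s * dot (grad F x) d) (dot (grad F x) d).
    apply: is_derive_eq; rewrite /GRing.scale /=; ring.
  have D3 : is_derive s 1 (fun s : R => L / 2 * sqnorm d * s ^+ 2) (L * sqnorm d * s).
    apply: is_derive_eq; rewrite /GRing.scale /=; by field.
  exact: is_deriveB (is_deriveB D1 D2) D3.
have phiC : {within `[0, 1], continuous phi}.
  apply: continuous_subspaceT => s.
  exact/differentiable_continuous/derivable1_diffP.
have [c c01] := MVT ltr01 (fun s _ => phiD s) phiC.
rewrite subr0 mulr1 /phi /dphi /= !fctE scale0r scale1r addr0 addrCA subrr addr0.
have c0 : 0 < c by move: c01; rewrite in_itv /= => /andP[].
(* Pairing with the whole increment [c *: d] puts a factor [c] on both sides, cancelled below. *)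
have : dot (grad F (x + c *: d) - grad F x) (c *: d) <= L * sqnorm (c *: d).
  apply: dot_le_lipschitz => //; apply: le_trans (lipF _ _) _.
  by rewrite addrAC subrr add0r.
rewrite sqnormZ dotZr dotDl dotNl expr2 -mulrA [L * _]mulrCA ler_pM2l// => h.
move: h; rewrite -/d mul1r expr1n expr0n/= mul0r !mulr0 !mulr1 !subr0.
have arith (A B C c' L' fx fy : R) : A - B <= L' * (c' * C) ->
  fy - B - L' / 2 * C - fx = A - B - L' * C * c' -> fy <= fx + B + L' / 2 * C.
  clear; lra.
exact: arith.
Qed.

End Descent.

Hypothesis cF : convex_fun F.

(** By convexity the difference quotients of [F] at [x] along [y - x] are at most [F y - F x] for
    steps in (0, 1]; let the step tend to 0. *)
Lemma grad_le x y : F x + dot (grad F x) (y - x) <= F y.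
Proof.
have D := is_derive_line x (y - x) 0.
have [dr dE] := D; move: dE; rewrite scale0r addr0 => dE.
rewrite addrC -lerBrDr -dE /derive.
have dr' := cvg_dnbhs_at_right dr.
apply: (cvgr_to_le dr'); near=> h.
have h0 : 0 < h by near: h; exact: nbhs_right_gt.
have h1 : h <= 1 by near: h; exact: nbhs_right_ltW.
rewrite /= addr0 scale0r addr0 [h *: 1]mulr1 -(ler_pM2l h0) [_ *: _]/(_ * _) mulrA.
rewrite divff ?gt_eqF// mul1r.
have := @cF y x h; rewrite (ltW h0) h1 => /(_ isT).
have -> : h *: y + (1 - h) *: x = x + h *: (y - x).
  by rewrite scalerBl scale1r scalerBr addrCA.
lra.
Unshelve. all: by end_near.
Qed.

(** The point [x - L^-1 *: D] minimizes the quadratic upper model at [x] of [F] minus its tangent at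
    [y]. There [F] is bounded below by the tangent at [y] and above by the descent lemma from
    [x]. *)
Lemma cocoercive (L : R) : 0 < L ->
  (forall x y, enorm (grad F x - grad F y) <= L * enorm (x - y)) ->
  forall x y, sqnorm (grad F x - grad F y)
    <= 2 * L * (F x - F y - dot (grad F y) (x - y)).
Proof.
move=> L0 lip x y; move DE : (grad F x - grad F y) => D.
have := grad_le y (x - L^-1 *: D).
have := descent_lemma _ (ltW L0) lip x (x - L^-1 *: D).
move: DE (F _) (F x) (F y); move: (grad F x) (grad F y) => gx gy DE fw fx fy.
have -> : x - L^-1 *: D - x = - (L^-1 *: D) by rewrite addrAC subrr add0r.
have -> : x - L^-1 *: D - y = (x - y) - L^-1 *: D by rewrite addrAC.
have DD : sqnorm D = dot gx D - dot gy D by rewrite sqnormE -{1}DE dotDl dotNl.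
move: DD; rewrite sqnormN sqnormZ dotNr (dotDr (x - y)) dotNr !dotZr.
move: (dot gx D) (dot gy D) (dot gy (x - y)) (sqnorm D) => A B C N DD h2 h1.
have Li : L / 2 * (L^-1 ^+ 2 * N) = L^-1 * N / 2 by field; rewrite gt_eqF.
have h : L^-1 * N <= 2 * (fx - fy - C).
  by move: h2; rewrite Li DD; lra.
by rewrite -[leLHS](mulVKf (lt0r_neq0 L0)) [2 * L]mulrC -[leRHS]mulrA ler_pM2l.
Qed.

End SmoothConvex.

(** * Proximal steps *)

(** Lets [t] tend to 0: if [b < a], the chosen [t] satisfies [t * |c| = e - t * e < e], a
    contradiction. *)
Lemma ler_of_small_slope {R : realType} (a b c : R) :
  (forall t, 0 < t -> t <= 1 -> a <= b + t * c) -> a <= b.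
Proof.
move=> h; rewrite leNgt; apply/negP => ba.
pose e := a - b; pose t := e / (e + `|c|).
have e0 : 0 < e by rewrite subr_gt0.
have c0 := normr_ge0 c; have cc := ler_norm c.
have s0 : 0 < e + `|c| by rewrite ltr_wpDr.
have t0 : 0 < t by rewrite divr_gt0.
have t1 : t <= 1 by rewrite ler_pdivrMr// mul1r lerDl.
have tE : t * (e + `|c|) = e by rewrite divfK ?gt_eqF.
have := h _ t0 t1; have := mulr_gt0 t0 e0; rewrite /e in tE *; nra.
Qed.

Section ConvexExtended.
Context {R : realType} {n : nat}.
Variable g : 'rV[R]_n -> \bar R.
Hypothesis g_proper : proper_efun g.
Hypothesis g_convex : convex_efun g.

Lemma convex_efun_fine x y (t : R) :
  g x \is a fin_num -> g y \is a fin_num -> 0 <= t <= 1 ->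
  g (t *: x + (1 - t) *: y) \is a fin_num /\
  fine (g (t *: x + (1 - t) *: y)) <= t * fine (g x) + (1 - t) * fine (g y).
Proof.
move=> fx fy t01; have := @g_convex x y t t01.
rewrite -[g x]fineK// -[g y]fineK//= -!EFinM -EFinD => h.
have fz : g (t *: x + (1 - t) *: y) \is a fin_num.
  by rewrite fin_numE g_proper.1 /= -ltey (le_lt_trans h)// ltry.
by split=> //; rewrite -lee_fin fineK.
Qed.

Lemma is_prox_fin_num (tau : R) y p : 0 < tau -> is_prox tau g y p ->
  g p \is a fin_num.
Proof.
move=> tau0 pr; have [gN [z gz]] := g_proper.
have fz : g z \is a fin_num by rewrite fin_numE gN -ltey.
rewrite fin_numE gN /=; apply/eqP => gp; have := pr z.
by rewrite gp -[g z]fineK// gt0_muley ?lte_fin// addye// -EFinM -EFinD leye_eq.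
Qed.

(** This says that [(y - p) / tau] is a subgradient of [g] at [p]. Compare [p] with [p + t (z - p)],
    divide by [t] and let [t] tend to 0. *)
Lemma is_prox_le (tau : R) y p z : 0 < tau -> is_prox tau g y p ->
  g z \is a fin_num ->
  tau * (fine (g p) - fine (g z)) <= dot (y - p) (p - z).
Proof.
move=> tau0 pr fz; have fp := is_prox_fin_num _ _ _ tau0 pr.
rewrite -subr_ge0.
apply: (@ler_of_small_slope _ _ _ (2^-1 * sqnorm (z - p))) => t t0 t1.
have [|fw gw] := convex_efun_fine z p t fz fp _; first by rewrite (ltW t0).
have := pr (t *: z + (1 - t) *: p).
rewrite -[g p]fineK// -[g (t *: z + _)]fineK// -!EFinM -!EFinD lee_fin.
have -> : y - (t *: z + (1 - t) *: p) = (y - p) - t *: (z - p).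
  by apply/rowP => j; rewrite !mxE; ring.
rewrite [sqnorm (_ - t *: _)]sqnormB dotZr sqnormZ.
have -> : dot (y - p) (p - z) = - dot (y - p) (z - p) by rewrite -dotNr opprB.
move: (dot (y - p) (z - p)) (sqnorm (z - p)) (sqnorm (y - p)) => A B C h.
have {}h : 0 <= t * (tau * (fine (g z) - fine (g p)) - A + t * (2^-1 * B)).
  have := ler_wpM2l (ltW tau0) gw.
  lra.
move: h; rewrite pmulr_rge0//; lra.
Qed.

End ConvexExtended.

(** * Means *)

Section Mean.
Context {R : realType} {d : measure_display} {I : measurableType d}.
Variable P : probability I R.

(** Pairing integrability with a real value makes means linear without side conditions. *)
Definition has_mean (F : I -> R) (m : R) :=
  P.-integrable setT (fun i => (F i)%:E) /\ (\int[P]_i (F i)%:E = m%:E)%E.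

Lemma has_mean_cst (c : R) : has_mean (fun=> c) c.
Proof.
split; first exact: finite_measure_integrable_cst.
rewrite integral_cst//; transitivity (c%:E * 1)%E; last by rewrite mule1.
by congr (_ * _)%E; exact: probability_setT.
Qed.

Lemma has_meanD F G (m m' : R) :
  has_mean F m -> has_mean G m' -> has_mean (fun i => F i + G i) (m + m').
Proof.
move=> [iF mF] [iG mG]; split; first exact: (integrableD measurableT iF iG).
by rewrite -[RHS]/(m%:E + m'%:E)%E -mF -mG -integralD.
Qed.

Lemma has_meanZ (k : R) F (m : R) : has_mean F m -> has_mean (fun i => k * F i) (k * m).
Proof.
move=> [iF mF]; split; first exact: (integrableZl measurableT k iF).
by rewrite -[RHS]/(k%:E * m%:E)%E -mF -integralZl.
Qed.

Lemma has_meanN F (m : R) : has_mean F m -> has_mean (fun i => - F i) (- m).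
Proof.
move=> /(has_meanZ (-1)); rewrite mulN1r.
by have -> : (fun i => -1 * F i) = (fun i => - F i) by apply/funext => i; rewrite mulN1r.
Qed.

Lemma has_mean_sum (n : nat) (F : 'I_n -> I -> R) (m : 'I_n -> R) :
  (forall j, has_mean (F j) (m j)) ->
  has_mean (fun i => \sum_(j < n) F j i) (\sum_(j < n) m j).
Proof.
elim: n F m => [|n IH] F m FM.
  rewrite big_ord0; have -> : (fun i => \sum_(j < 0) F j i) = (fun=> 0).
    by apply/funext => i; rewrite big_ord0.
  exact: has_mean_cst.
rewrite big_ord_recl; have -> : (fun i => \sum_(j < n.+1) F j i)
    = (fun i => F ord0 i + \sum_(j < n) F (lift ord0 j) i).
  by apply/funext => i; rewrite big_ord_recl.
by apply: has_meanD => //; apply: (IH (fun j => F (lift ord0 j))) => j.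
Qed.

Lemma has_mean_dotl (n : nat) (F : I -> 'rV[R]_n) (m v : 'rV[R]_n) :
  (forall j, has_mean (fun i => F i 0 j) (m 0 j)) ->
  has_mean (fun i => dot (F i) v) (dot m v).
Proof.
move=> FM; apply: has_mean_sum => j; rewrite mulrC.
have -> : (fun i => F i 0 j * v 0 j) = (fun i => v 0 j * F i 0 j).
  by apply/funext => i; rewrite mulrC.
exact: has_meanZ.
Qed.

Lemma has_mean_le F G (m m' : R) :
  has_mean F m -> has_mean G m' -> (forall i, F i <= G i) -> m <= m'.
Proof.
move=> [iF mF] [iG mG] FG; rewrite -lee_fin -mF -mG.
by apply: le_integral => // i _; rewrite lee_fin.
Qed.

Lemma has_mean_sqnorm (n : nat) (F : I -> 'rV[R]_n) :
  (forall j, measurable_fun setT (fun i => F i 0 j)) ->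
  (\int[P]_i (sqnorm (F i))%:E < +oo)%E ->
  exists2 m : R, has_mean (fun i => sqnorm (F i)) m & 0 <= m.
Proof.
move=> mF Foo.
have I0 : (0 <= \int[P]_i (sqnorm (F i))%:E)%E.
  by apply: integral_ge0 => i _; rewrite lee_fin sqnorm_ge0.
have fnI : (\int[P]_i (sqnorm (F i))%:E)%E \is a fin_num by rewrite ge0_fin_numE.
exists (fine (\int[P]_i (sqnorm (F i))%:E)%E); last exact: fine_ge0.
split; last by rewrite fineK.
apply/integrableP; split.
  apply/measurable_EFinP; apply: measurable_sum => j.
  exact: measurable_funX.
under eq_integral => i _ do rewrite abse_EFin ger0_norm ?sqnorm_ge0//.
exact: Foo.
Qed.

(* The integral of a nonnegative function is a supremum over the simple functions
   below it, so it is monotone without any measurability assumption. *)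
Lemma ge0_le_integralT (f1 f2 : I -> \bar R) :
  (forall i, 0 <= f1 i)%E -> (forall i, f1 i <= f2 i)%E ->
  (\int[P]_i f1 i <= \int[P]_i f2 i)%E.
Proof.
move=> f10 f12; have f20 i : (0 <= f2 i)%E := le_trans (f10 i) (f12 i).
rewrite !ge0_integralTE//; apply: ereal_sup_le => _ [h hf <-].
by exists h => // i; exact: le_trans (hf i) (f12 i).
Qed.

Lemma Eiter_ge0 (k : nat) (F : seq I -> \bar R) :
  (forall s, 0 <= F s)%E -> (0 <= Eiter P k F)%E.
Proof.
elim: k F => [|k IH] F F0 //=.
by apply: integral_ge0 => i _; apply: IH.
Qed.

End Mean.

(** * Weights *)

Section Weights.
Context {R : realType}.
Implicit Types (a : R) (k T : nat).

(* The weights solve [weight a k.+1 = growth a k * mix a k + a * weight a k] and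
   [growth a k.+1 = growth a k + a * weight a k], which is what the induction in
   [Eiter_gap_le] requires of the coefficients of its potential. *)
Definition growth a k : R := \prod_(j < k) (1 + a / j.+1%:R).
Definition weight a k : R := growth a k / k.+1%:R.

Lemma growth0 a : growth a 0 = 1.
Proof. by rewrite /growth big_ord0. Qed.

Lemma weight0 a : weight a 0 = 1.
Proof. by rewrite /weight growth0 divr1. Qed.

Lemma growthS a k : growth a k.+1 = growth a k + a * weight a k.
Proof. by rewrite /weight /growth big_ord_recr /=; ring. Qed.

Lemma growth_ge1 a k : 0 <= a -> 1 <= growth a k.
Proof.
move=> a0; elim: k => [|k IH]; first by rewrite growth0.
rewrite growthS (le_trans IH)// lerDl mulr_ge0// divr_ge0 ?ler0n//.
exact: le_trans IH.
Qed.

Lemma weight_ge0 a k : 0 <= a -> 0 <= weight a k.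
Proof.
by move=> a0; rewrite divr_ge0 ?ler0n// (le_trans _ (growth_ge1 _ k a0)).
Qed.

(** The share of the current iterate in the next reference point, equal to
    [1 - weight a k.+1 / weight a k]. *)
Definition mix a k : R := (1 - a) / k.+2%:R.

Section Recursion.
Variable a : R.
Hypothesis a01 : 0 <= a <= 1.

Lemma mix01 k : 0 <= mix a k <= 1.
Proof.
have /andP[a0 a1] := a01; rewrite /mix divr_ge0 ?ler0n ?subr_ge0//=.
rewrite ler_pdivrMr ?ltr0n// mul1r (@le_trans _ _ 1) ?ler1n//.
by rewrite lerBlDr lerDl.
Qed.

Lemma weightS k : weight a k.+1 = growth a k * mix a k + a * weight a k.
Proof.
rewrite /weight /mix growthS /weight -[k.+2%:R]natr1 -[k.+1%:R]natr1.
have k0 : k%:R + 1 != 0 :> R by rewrite natr1.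
have k1 : k%:R + 1 + 1 != 0 :> R by rewrite !natr1.
field; by rewrite k0 k1.
Qed.

Lemma growth_mix k :
  growth a k * (1 - mix a k) = growth a k.+1 - weight a k.+1.
Proof. rewrite weightS growthS; ring. Qed.

(** One factor [1 - mix a k] already turns [weight a k] into [weight a k.+1]; the other is at most
    1. *)
Lemma weight_mix k : weight a k * (1 - mix a k) ^+ 2 <= weight a k.+1.
Proof.
have /andP[a0 a1] := a01; have /andP[p0 p1] := mix01 k.
have w0 := weight_ge0 _ k a0.
have : weight a k * (1 - mix a k) = weight a k.+1.
  rewrite weightS /mix.
  have -> : growth a k = weight a k * k.+1%:R.
    by rewrite /weight divfK.
  rewrite -[k.+2%:R]natr1; have k1 : k.+1%:R + 1 != 0 :> R by rewrite !natr1.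
  by field.
by move=> <-; have := mulr_ge0 p0 w0; rewrite expr2; nra.
Qed.

End Recursion.

(** Each new term satisfies [1/(k+2) <= ln ((k+2)/(k+1))], from [ln (1 + y) <= y] at
    [y = -1/(k+2)]. *)
Lemma harmonic_le_ln k : \sum_(j < k.+1) (j.+1%:R : R)^-1 <= 1 + ln (k.+1%:R : R).
Proof.
elim: k => [|k IH]; first by rewrite big_ord1 invr1 ln1 addr0.
rewrite big_ord_recr /= (le_trans (lerD IH (lexx _)))// -addrA lerD2l.
rewrite -lerBrDl -ln_div ?posrE ?ltr0n// -lerN2 -lnV ?posrE ?divr_gt0 ?ltr0n//.
rewrite invf_div; have -> : k.+1%:R / k.+2%:R = 1 + - (k.+2%:R)^-1 :> R.
  rewrite -[k.+2%:R]natr1; have k1 : k.+1%:R + 1 != 0 :> R by rewrite !natr1.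
  by field.
by apply: le_ln1Dx; rewrite ltrN2 invf_lt1 ?ltr0n// ltr1n.
Qed.

(** With [u = sqrt x], the tangent bound for [exp] at [ln u - 1/2] gives
    [u >= exp (1/2) * (ln u + 1/2)], and [exp (1/2) >= 3/2]. *)
Lemma ln1D_le_sqrt (x : R) : 0 < x -> 1 + ln x <= 4 / 3 * Num.sqrt x.
Proof.
move=> x0; set u := Num.sqrt x; have u0 : 0 < u by rewrite sqrtr_gt0.
have -> : ln x = 2 * ln u by rewrite -(sqr_sqrtr (ltW x0)) -/u lnXn// mulr_natl.
have h1 := expR_ge1Dx (ln u - 2^-1 : R).
have h2 := expR_ge1Dx (2^-1 : R).
move: h1; rewrite expRB lnK ?posrE//.
have e0 := expR_gt0 (2^-1 : R).
rewrite ler_pdivlMr// => h1.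
have [l0|l0] := lerP 0 (ln u + 2^-1); last by nra.
by nra.
Qed.

(** From [1 + y <= exp y], the product is at most [exp (a * (1 + ln T)) <= exp (4/3)]. As
    [exp (-1/3) >= 2/3], this is at most [(3/2)^4 = 81/16]. *)
Lemma growth_le6 T : (0 < T)%N -> growth (Num.sqrt (T%:R : R))^-1 T <= 6.
Proof.
case: T => // T _; set x : R := T.+1%:R; set a := (Num.sqrt x)^-1.
have x0 : 0 < x by rewrite ltr0n.
have u0 : 0 < Num.sqrt x by rewrite sqrtr_gt0.
have a0 : 0 < a by rewrite invr_gt0.
have : growth a T.+1 <= expR (a * \sum_(j < T.+1) (j.+1%:R : R)^-1).
  rewrite /growth mulr_sumr expR_sum; apply: ler_prod => j _.
  by rewrite expR_ge1Dx andbT addr_ge0// divr_ge0 ?ler0n// ltW.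
move/le_trans; apply.
have : expR (a * \sum_(j < T.+1) (j.+1%:R : R)^-1) <= expR (4%:R * 3^-1 : R).
  rewrite ler_expR mulrC ler_pdivrMr//.
  exact: le_trans (harmonic_le_ln T) (ln1D_le_sqrt _ x0).
move/le_trans; apply; rewrite expRM_natl.
have e1 : expR (3^-1 : R) <= 3 / 2.
  rewrite -[leLHS]invrK -expRN -[leRHS]invrK lef_pV2 ?posrE ?expR_gt0 ?invr_gt0 ?divr_gt0//.
  by apply: le_trans (expR_ge1Dx _); lra.
have e0 := expR_ge0 (3^-1 : R).
apply: (@le_trans _ _ ((3 / 2) ^+ 4)); last by lra.
by rewrite lerXn2r ?nnegrE// divr_ge0.
Qed.

Section Bounds.
Variable T : nat.
Hypothesis T1 : (0 < T)%N.
Let a : R := (Num.sqrt T%:R)^-1.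

Lemma inv_sqrt_nat01 : 0 <= a <= 1.
Proof.
rewrite invr_ge0 sqrtr_ge0 /= invf_le1 ?sqrtr_gt0 ?ltr0n//.
by rewrite -[leLHS]sqrtr1 ler_sqrt ?ler0n// ler1n.
Qed.

Lemma growth_le6_before k : (k <= T)%N -> growth a k <= 6.
Proof.
move=> kT; apply: le_trans (growth_le6 _ T1).
have /andP[a0 _] := inv_sqrt_nat01.
suff gm m : growth a k <= growth a (k + m) by have := gm (T - k)%N; rewrite subnKC.
elim: m => [|m IH]; first by rewrite addn0.
by rewrite addnS growthS (le_trans IH)// lerDl mulr_ge0// weight_ge0.
Qed.

Lemma weight_last_le : weight a T.+1 <= 6 / T%:R.
Proof.
have /andP[a0 a1] := inv_sqrt_nat01.
have T0 : 0 < T%:R :> R by rewrite ltr0n.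
have gT := growth_le6_before _ (leqnn T); have g1 := growth_ge1 _ T a0.
have wT : weight a T <= 6 / T%:R.
  apply: ler_pM => //; first exact: le_trans g1.
  by rewrite lef_pV2 ?posrE ?ltr0n// ler_nat.
rewrite /weight ler_pdivrMr ?ltr0n// growthS.
have -> : 6 / T%:R * T.+2%:R = 6 + 2 * (6 / T%:R) :> R.
  rewrite -[T.+2%:R]natr1 -[T.+1%:R]natr1; field; exact: lt0r_neq0.
have := weight_ge0 _ T a0; nra.
Qed.

(** Termwise [weight a k <= 6/(k+1)], and [ln (T+1) >= 1/2] absorbs the constant 6. The values 18
    and 72 are those that [last_gap_bound] turns into the final noise term. *)
Lemma sum_weight_le :
  \sum_(k < T.+1) weight a k <= 18 / T%:R + 72 * ln (T.+1%:R : R).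
Proof.
have T0 : 0 < T%:R :> R by rewrite ltr0n.
apply: (@le_trans _ _ (6 * (1 + ln (T.+1%:R : R)))).
  apply: le_trans (ler_wpM2l _ (harmonic_le_ln T)) => //.
  rewrite mulr_sumr; apply: ler_sum => k _.
  by rewrite /weight ler_wpM2r ?invr_ge0 ?ler0n// growth_le6_before// -ltnS.
have l2 : 2^-1 <= ln (T.+1%:R : R).
  rewrite -[leLHS]opprK lerNl -lnV ?posrE ?ltr0n//.
  have -> : (T.+1%:R : R)^-1 = 1 + ((T.+1%:R)^-1 - 1) by ring.
  apply: le_trans (le_ln1Dx _) _.
    by rewrite ltrBrDr addNr invr_gt0 ltr0n.
  have : (T.+1%:R : R)^-1 <= 2^-1 by rewrite lef_pV2 ?posrE ?ltr0n// ler_nat.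
  by move: (T.+1%:R^-1) => r; lra.
have : 0 <= 18 / T%:R :> R by rewrite divr_ge0// ltW.
by nra.
Qed.

End Bounds.
End Weights.

(** * Proximal stochastic gradient descent *)

Section ProximalSGD.
Context {R : realType} {n : nat} {d : measure_display} {I : measurableType d}.
Variables (P : probability I R) (fi : I -> 'rV[R]_n -> R) (f : 'rV[R]_n -> R).
Variables (Gi : I -> 'rV[R]_n -> 'rV[R]_n) (Gf : 'rV[R]_n -> 'rV[R]_n).
Variables (g : 'rV[R]_n -> \bar R) (L tau sigma2 : R) (xs : 'rV[R]_n).

Hypothesis L_gt0 : 0 < L.
Hypothesis fi_grad_le : forall i x y, fi i x + dot (Gi i x) (y - x) <= fi i y.
Hypothesis fi_descent : forall i x y,
  fi i y <= fi i x + dot (Gi i x) (y - x) + L / 2 * sqnorm (y - x).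
Hypothesis fi_cocoercive : forall i x y,
  sqnorm (Gi i x - Gi i y) <= 2 * L * (fi i x - fi i y - dot (Gi i y) (x - y)).
Hypothesis mean_fi : forall x, has_mean P (fun i => fi i x) (f x).
Hypothesis mean_Gi : forall x j, has_mean P (fun i => Gi i x 0 j) (Gf x 0 j).
Hypothesis g_proper : proper_efun g.
Hypothesis g_convex : convex_efun g.
Hypothesis g_xs : g xs \is a fin_num.
Hypothesis xs_min : forall x, g x \is a fin_num ->
  f xs + fine (g xs) <= f x + fine (g x).
Hypothesis mean_sigma : has_mean P (fun i => sqnorm (Gi i xs)) sigma2.
Hypothesis tau_gt0 : 0 < tau.
Hypothesis tauL : 3 * tau * L <= 1.

(** Where [g x] is infinite, [fine] returns 0 and the value is meaningless; the estimates are
    therefore stated at points where [g] is finite. *)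
Definition gap x := f x + fine (g x) - (f xs + fine (g xs)).

Lemma gap_ge0 x : g x \is a fin_num -> 0 <= gap x.
Proof. by move=> gx; rewrite subr_ge0 xs_min. Qed.

(** The inequality is linear in the random value and gradient, so it passes to the mean. *)
Lemma mean_grad_le x y : f x + dot (Gf x) (y - x) <= f y.
Proof.
apply: (has_mean_le P _ _ _ _ _ (mean_fi y) (fun i => fi_grad_le i x y)).
by apply: has_meanD => //; exact: has_mean_dotl.
Qed.

Lemma mean_descent x y :
  f y <= f x + dot (Gf x) (y - x) + L / 2 * sqnorm (y - x).
Proof.
apply: (has_mean_le P _ _ _ _ (mean_fi y) _ (fun i => fi_descent i x y)).
apply: has_meanD; last exact: has_mean_cst.
by apply: has_meanD => //; exact: has_mean_dotl.
Qed.

(** For the [f] part, average the tangent inequalities at the combination [w]; their linear terms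
    cancel. *)
Lemma gap_convex x y (t : R) :
  g x \is a fin_num -> g y \is a fin_num -> 0 <= t <= 1 ->
  gap (t *: x + (1 - t) *: y) <= t * gap x + (1 - t) * gap y.
Proof.
move=> gx gy t01; have [_] := convex_efun_fine g g_proper g_convex x y t gx gy t01.
rewrite /gap; set w := t *: x + (1 - t) *: y.
have hx := mean_grad_le w x; have hy := mean_grad_le w y.
have : t * dot (Gf w) (x - w) + (1 - t) * dot (Gf w) (y - w) = 0.
  rewrite -!dotZr -dotDr; suff -> : t *: (x - w) + (1 - t) *: (y - w) = 0.
    by rewrite -(scale0r 0) dotZr mul0r.
  by apply/rowP => j; rewrite /w !mxE; ring.
have /andP[t0 t1] := t01.
have {}hx := ler_wpM2l t0 hx.
have {}hy : (1 - t) * (f w + dot (Gf w) (y - w)) <= (1 - t) * f y.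
  by rewrite ler_wpM2l// subr_ge0.
move: hx hy; clearbody w; lra.
Qed.

(* First-order optimality: [- Gf xs] is a subgradient of [g] at [xs]. *)
Lemma minimizer_subgrad x : g x \is a fin_num ->
  fine (g xs) - fine (g x) <= dot (Gf xs) (x - xs).
Proof.
move=> gx; apply: (@ler_of_small_slope _ _ _ (L / 2 * sqnorm (x - xs))) => t t0 t1.
rewrite -(ler_pM2l t0).
have t01 : 0 <= t <= 1 by rewrite (ltW t0).
have [gw wle] := convex_efun_fine g g_proper g_convex x xs t gx g_xs t01.
have := mean_descent xs (t *: x + (1 - t) *: xs); have := xs_min _ gw.
have -> : t *: x + (1 - t) *: xs - xs = t *: (x - xs).
  by apply/rowP => j; rewrite !mxE; ring.
rewrite dotZr sqnormZ; move: wle.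
move: (fine (g (t *: x + (1 - t) *: xs))) (f (t *: x + (1 - t) *: xs)) => a b.
lra.
Qed.

Lemma prox_step_le x p z i :
  is_prox tau g (x - tau *: Gi i x) p -> g z \is a fin_num ->
  gap p + (2 * tau)^-1 * sqnorm (p - z)
    <= gap z + (2 * tau)^-1 * sqnorm (x - z) + (f x - f z)
       - dot (Gi i x) (x - z) + 3 / 4 * tau * sqnorm (Gi i x - Gf x).
Proof.
move=> pr gz; have := is_prox_le g g_proper g_convex _ _ _ _ tau_gt0 pr gz.
have := mean_descent x p.
(* The distance identity supplies [|x - p|^2 / (2 tau)]. The smoothness term takes at most
   [1/(6 tau)] of it, as [3 tau L <= 1]; this parameter makes Young's inequality use the remaining
   [1/(3 tau)]. *)
have := dot_young (3 / 2 * tau) (Gi i x - Gf x) (x - p); rewrite pmulr_rgt0// => /(_ tau_gt0).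
move: (Gi i x) (Gf x) => G H.
have -> : (3 / 2 * tau)^-1 = 4 / 3 * (2 * tau)^-1 by field; exact: lt0r_neq0.
have : tau * (2 * tau)^-1 = 2^-1 by field; exact: lt0r_neq0.
rewrite /gap; move: ((2 * tau)^-1) => U tU.
have -> : dot (x - tau *: G - p) (p - z) =
    (sqnorm (x - z) - sqnorm (p - z) - sqnorm (x - p)) / 2
    - tau * (dot G (p - x) + dot G (x - z)).
  rewrite !sqnormB !sqnormE !dotE; by field.
have -> : dot (G - H) (x - p) = dot H (p - x) - dot G (p - x).
  by rewrite !dotE; ring.
rewrite (sqnormBC p x); have := sqnorm_ge0 (x - p); move: tauL tau_gt0 tU; clear.
move: (sqnorm (x - p)) (sqnorm (x - z)) (sqnorm (p - z)) (sqnorm (G - H))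
  (dot G (p - x)) (dot H (p - x)) (dot G (x - z)) (f p) (f x) (f z)
  (fine (g p)) (fine (g z)) (f xs + _).
move=> N Nxz Npz M Gp Hp Gz fp fx fz gp gz hs tL t0 tU N0 h1 h2 h3.
rewrite -(ler_pM2l t0).
have {}h1 := ler_wpM2l (ltW t0) h1; have {}h2 := ler_wpM2l (ltW t0) h2.
have {}tL := ler_wpM2r N0 tL.
have e1 : tau * U * N = 2^-1 * N by rewrite tU.
have e2 : tau * U * Nxz = 2^-1 * Nxz by rewrite tU.
have e3 : tau * U * Npz = 2^-1 * Npz by rewrite tU.
lra.
Qed.

(** [B] is independent of [p]. The variance is expanded and [|Gi i x|^2] split around [Gi i xs] and
    bounded by cocoercivity, so every random term left has a known mean. *)
Lemma mean_prox_step x z : g x \is a fin_num -> g z \is a fin_num ->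
  exists B m, [/\ has_mean P B m,
    forall i p, is_prox tau g (x - tau *: Gi i x) p ->
      gap p + (2 * tau)^-1 * sqnorm (p - z) <= B i &
    m <= gap z + (2 * tau)^-1 * sqnorm (x - z) + 3 * tau * L * gap x
         + 3 / 2 * tau * sigma2].
Proof.
move=> gx gz; set c := gap z + (2 * tau)^-1 * sqnorm (x - z) + (f x - f z).
exists (fun i => c - dot (Gi i x) (x - z) + 3 / 4 * tau *
  (4 * L * (fi i x - fi i xs - dot (Gi i xs) (x - xs))
   + 2 * sqnorm (Gi i xs) + - 2 * dot (Gi i x) (Gf x) + sqnorm (Gf x))).
exists (c - dot (Gf x) (x - z) + 3 / 4 * tau *
  (4 * L * (f x - f xs - dot (Gf xs) (x - xs))
   + 2 * sigma2 + - 2 * dot (Gf x) (Gf x) + sqnorm (Gf x))).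
have mG y v : has_mean P (fun i => dot (Gi i y) v) (dot (Gf y) v).
  by apply: has_mean_dotl.
split.
- apply: has_meanD.
    by apply: has_meanD; [exact: has_mean_cst | exact: has_meanN].
  apply: has_meanZ; apply: has_meanD; last exact: has_mean_cst.
  apply: has_meanD; last exact: has_meanZ.
  apply: has_meanD; last exact: has_meanZ.
  apply: has_meanZ; apply: has_meanD; last exact: has_meanN.
  by apply: has_meanD => //; exact: has_meanN.
- move=> i p pr; apply: le_trans (prox_step_le _ _ _ _ pr gz) _.
  rewrite -/c lerD2l ler_wpM2l//; first by have := tau_gt0; lra.
  have := sqnorm_le2 (Gi i x) (Gi i xs); have := fi_cocoercive i x xs.
  rewrite [sqnorm (_ - Gf x)]sqnormB.
  move: (sqnorm (_ - _)) (sqnorm (Gi i x)) (sqnorm (Gi i xs)) (dot _ _) (dot _ _).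
  by move=> *; lra.
(* In the mean, convexity absorbs the linear term in [x - z], and optimality of [xs] bounds the
   Bregman term by [gap x]; the squared norm of [Gf x] survives with a negative sign. *)
have h1 := mean_grad_le x z; have h2 := minimizer_subgrad _ gx.
have : f x - f z - dot (Gf x) (x - z) <= 0.
  have -> : dot (Gf x) (x - z) = - dot (Gf x) (z - x) by rewrite -dotNr opprB.
  by move: h1; move: (dot _ _) => *; lra.
have : L * tau * (f x - f xs - dot (Gf xs) (x - xs)) <= L * tau * gap x.
  rewrite ler_pM2l ?mulr_gt0// /gap; lra.
have : 0 <= tau * dot (Gf x) (Gf x) by rewrite mulr_ge0 ?(ltW tau_gt0)// -sqnormE sqnorm_ge0.
rewrite sqnormE /c.
move: (dot (Gf x) (Gf x)) (dot (Gf x) (x - z)) (dot (Gf xs) (x - xs)) (gap x) (gap z)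
  ((2 * tau)^-1 * _) => *; lra.
Qed.

Variable X : seq I -> 'rV[R]_n.
Hypothesis X_step : forall s i, is_prox tau g (X s - tau *: Gi i (X s)) (X (rcons s i)).
Hypothesis g_X0 : g (X [::]) \is a fin_num.

Lemma g_X s : g (X s) \is a fin_num.
Proof. by case/lastP: s => [//|s i]; exact: is_prox_fin_num (X_step s i). Qed.

Let a := 3 * tau * L.

(* The reference point [z] is dragged towards the current iterate at each step; this is
   what turns a bound on an average of the gaps into a bound on the last gap. *)
Lemma Eiter_gap_le k s z : g z \is a fin_num ->
  (Eiter P k (fun s' => (gap (X (s ++ s')))%:E)
   <= (weight a k * ((2 * tau)^-1 * sqnorm (X s - z))
       + (growth a k - weight a k) * gap z + weight a k * gap (X s)
       + 3 / 2 * tau * sigma2 * \sum_(j < k) weight a j)%:E)%E.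
Proof.
have a0 : 0 <= a by rewrite /a !mulr_ge0// ltW.
have a01 : 0 <= a <= 1 by rewrite a0.
have U0 : 0 < (2 * tau)^-1 by rewrite invr_gt0 mulr_gt0.
(* Induction on the number of steps still to run, for every past [s] and every reference [z]. *)
elim: k s z => [|k IH] s z gz.
  rewrite /= cats0 growth0 weight0 big_ord0 subrr mul0r mulr0 !addr0 mul1r lee_fin.
  by rewrite mul1r lerDr mulr_ge0 ?(ltW U0) ?sqnorm_ge0.
set q := 1 - mix a k; set x := X s.
have q01 : 0 <= q <= 1.
  by have /andP[p0 p1] := mix01 _ a01 k; rewrite /q; apply/andP; split; lra.
pose z' := q *: z + (1 - q) *: x.
have [gz' _] := convex_efun_fine g g_proper g_convex z x q gz (g_X s) q01.
have z'gap : gap z' <= q * gap z + (1 - q) * gap x by apply: gap_convex => //; exact: g_X.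
have [B [m [mB Bge mle]]] := mean_prox_step x z' (g_X s) gz'.
pose C := (growth a k - weight a k) * gap z' + 3 / 2 * tau * sigma2 * \sum_(j < k) weight a j.
have w0 := weight_ge0 _ k a0.
have mBC : has_mean P (fun i => weight a k * B i + C) (weight a k * m + C).
  by apply: has_meanD; [exact: has_meanZ | exact: has_mean_cst].
rewrite /=; apply: (@le_trans _ _ (weight a k * m + C)%:E).
  (* The induction hypothesis, with [i] appended to the past and reference [z'], bounds the inner
     expectation by a function of [i] with known mean. *)
  rewrite -mBC.2; apply: ge0_le_integralT => i.
    by apply: Eiter_ge0 => s'; rewrite lee_fin gap_ge0// g_X.
  have -> : (fun s' => (gap (X (s ++ i :: s')))%:E) =
            (fun s' => (gap (X (rcons s i ++ s')))%:E).
    by apply/funext => s'; rewrite cat_rcons.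
  apply: le_trans (IH _ z' gz') _; rewrite lee_fin.
  have := ler_wpM2l w0 (Bge i _ (X_step s i)).
  rewrite /C; move: (growth _ _ - _) (gap z') (gap _) (sqnorm _) => *; lra.
(* [gap z'] now has total coefficient [growth a k]. Convexity splits it between [z] and [x],
   yielding the coefficients for [k.+1]; the distance term shrinks by [q ^+ 2]. *)
rewrite lee_fin /C.
have xz' : sqnorm (x - z') = q ^+ 2 * sqnorm (x - z).
  rewrite -sqnormZ; congr sqnorm; apply/rowP => j; rewrite /z' !mxE; ring.
move: mle; rewrite xz' => /(ler_wpM2l w0) mle.
have h1 : weight a k * q ^+ 2 * ((2 * tau)^-1 * sqnorm (x - z))
    <= weight a k.+1 * ((2 * tau)^-1 * sqnorm (x - z)).
  by rewrite ler_wpM2r ?weight_mix// mulr_ge0 ?(ltW U0) ?sqnorm_ge0.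
have g0 : 0 <= growth a k by rewrite (le_trans _ (growth_ge1 _ k a0)).
have h2 := ler_wpM2l g0 z'gap.
rewrite big_ord_recr /= -growth_mix weightS -/q.
rewrite weightS in h1.
have q1 : mix a k = 1 - q by rewrite /q; ring.
rewrite q1 in h1 *; rewrite -/a in mle.
move: h1 h2 mle.
move: (\sum_(j < k) _) ((2 * tau)^-1) (sqnorm _) (gap z') (gap z) (gap x) (weight a k) (growth a k).
move=> S U N dz' dz dx w G h1 h2 mle; lra.
Qed.

End ProximalSGD.

(** The 9 is [6 * 3/2]: the last weight is at most [6 / T] and [1 / (2 tau)] equals
    [3/2 * L * sqrt T]. *)
Lemma last_gap_bound {R : realType} (T : nat) (L tau N dx s2 : R) :
  (0 < T)%N -> 0 < L -> tau = (3 * L * Num.sqrt T%:R)^-1 ->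
  0 <= N -> 0 <= dx -> 0 <= s2 ->
  weight (3 * tau * L) T.+1 * ((2 * tau)^-1 * N) + weight (3 * tau * L) T.+1 * dx
    + 3 / 2 * tau * s2 * \sum_(j < T.+1) weight (3 * tau * L) j
  <= 9 / Num.sqrt T%:R * (L * N + (Num.sqrt T%:R)^-1 * dx
       + s2 * (L^-1 * (T%:R^-1 + 4 * ln T.+1%:R))).
Proof.
move=> T1 L0 tauE N0 dx0 s20.
have T0 : 0 < T%:R :> R by rewrite ltr0n.
have u0 : 0 < Num.sqrt (T%:R : R) by rewrite sqrtr_gt0.
have aE : 3 * tau * L = (Num.sqrt T%:R)^-1.
  by rewrite tauE; field; rewrite !lt0r_neq0.
rewrite aE; have := @sum_weight_le R _ T1; have := @weight_last_le R _ T1.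
rewrite -[X in 6 / X](sqr_sqrtr (ltW T0)).
move: (weight _ T.+1) (\sum_(j < _) _) => w S wle Sle.
have -> : 3 / 2 * tau = (2 * L * Num.sqrt T%:R)^-1.
  by rewrite tauE; field; rewrite !lt0r_neq0.
have -> : (2 * tau)^-1 = 3 / 2 * L * Num.sqrt T%:R.
  by rewrite tauE; field; rewrite !lt0r_neq0.
move: (Num.sqrt _) u0 wle => u u0 wle.
rewrite !mulrDr; apply: lerD; first apply: lerD.
- have := ler_wpM2r (mulr_ge0 (mulr_ge0 (ltW L0) (ltW u0)) N0) wle.
  have -> : 6 / u ^+ 2 * (L * u * N) = 6 * (L * N / u).
    by field; rewrite lt0r_neq0.
  have -> : 9 / u * (L * N) = 9 * (L * N / u) by ring.
  move: (L * N / u) => r; lra.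
- have := ler_wpM2r dx0 wle; have : 0 <= dx / u ^+ 2 by rewrite divr_ge0 ?exprn_ge0 ?(ltW u0).
  have -> : 9 / u * (u^-1 * dx) = 9 * (dx / u ^+ 2) by field; rewrite lt0r_neq0.
  have -> : 6 / u ^+ 2 * dx = 6 * (dx / u ^+ 2) by ring.
  move: (dx / _) => r; lra.
have c0 : 0 <= (2 * L * u)^-1 * s2.
  by rewrite mulr_ge0// invr_ge0 !mulr_ge0 ?(ltW L0) ?(ltW u0).
apply: le_trans (ler_wpM2l c0 Sle) _; rewrite le_eqVlt; apply/orP; left; apply/eqP.
move: (ln _) (T%:R) T0 => l t t0; by field; rewrite !lt0r_neq0.
Qed.

Theorem theorem3p1 (R : realType) (n : nat) (d : measure_display)
  (I : measurableType d) (P : probability I R)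
  (fi : I -> 'rV[R]_n -> R) (f : 'rV[R]_n -> R) (g : 'rV[R]_n -> \bar R)
  (L : R) (x0 xs : 'rV[R]_n) (T : nat) (X : seq I -> 'rV[R]_n) :
  0 < L ->
  (* each f_i convex, differentiable, with L-Lipschitz gradient *)
  (forall i, convex_fun (fi i)) ->
  (forall i x, differentiable (fi i) x) ->
  (forall i x y, enorm (grad (fi i) x - grad (fi i) y) <= L * enorm (x - y)) ->
  (* f = E_i f_i, and E_i grad f_i = grad f *)
  (forall x, P.-integrable setT (fun i => (fi i x)%:E) /\
             (\int[P]_i (fi i x)%:E = (f x)%:E)%E) ->
  (forall x, differentiable f x) ->
  (forall x (j : 'I_n), P.-integrable setT (fun i => (grad (fi i) x 0 j)%:E) /\
             (\int[P]_i (grad (fi i) x 0 j)%:E = (grad f x 0 j)%:E)%E) ->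
  (* g proper, convex, lower semicontinuous *)
  proper_efun g -> convex_efun g -> lower_semicontinuous g ->
  let h := fun x => ((f x)%:E + g x)%E in
  (* xs is a minimizer of h with finite sigma_*^2 *)
  argmin_set h xs ->
  (\int[P]_i (sqnorm (grad (fi i) xs))%:E < +oo)%E ->
  (1 <= T)%N ->
  let tau := (3 * L * Num.sqrt T%:R)^-1 in
  (* proximal SGD: x_t = X [:: i_0; ...; i_{t-1}] *)
  X [::] = x0 ->
  (forall s i, is_prox tau g (X s - tau *: grad (fi i) (X s)) (X (rcons s i))) ->
  let hstar := h xs in
  let Dstar2 := inf [set sqnorm (y - x0) | y in argmin_set h] in
  let sigma2 := (\int[P]_i (sqnorm (grad (fi i) xs))%:E)%E in
  (Eiter P T.+1 (fun s => h (X s) - hstar)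
    <= (9 / Num.sqrt T%:R)%:E *
       ((L * Dstar2)%:E + ((Num.sqrt T%:R)^-1)%:E * (h x0 - hstar)
        + sigma2 * (L^-1 * (T%:R^-1 + 4 * ln (T.+1)%:R))%:E))%E.
Proof.
move=> L0 fcv fdf flip fmean df gmean gp gc _ h hmin sfin T1 tau X0 Xst.
cbv zeta; set hstar := h xs; set Dstar2 := inf _; set sigma2 := integral P setT _.
have u0 : 0 < Num.sqrt (T%:R : R) by rewrite sqrtr_gt0 ltr0n.
have tau0 : 0 < tau by rewrite invr_gt0 !mulr_gt0.
have aE : 3 * tau * L = (Num.sqrt T%:R)^-1.
  by rewrite /tau; field; rewrite !lt0r_neq0.
have tauL : 3 * tau * L <= 1.
  by rewrite aE; have /andP[] := @inv_sqrt_nat01 R _ T1.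
have argmin_fin y : argmin_set h y -> g y \is a fin_num.
  move=> hy; have [gN [z gz]] := gp; rewrite fin_numE gN /=; apply/eqP => gy.
  have fz : g z \is a fin_num by rewrite fin_numE gN -ltey.
  by have := hy z; rewrite /h gy -[g z]fineK// addey// -EFinD leye_eq.
have gxs := argmin_fin _ hmin.
have hE y : g y \is a fin_num -> h y = (f y + fine (g y))%:E.
  by move=> gy; rewrite EFinD fineK.
have gapE y : g y \is a fin_num -> (h y - hstar)%E = (gap f g xs y)%:E.
  by move=> gy; rewrite /hstar !hE// -EFinB.
have xs_min y : g y \is a fin_num -> f xs + fine (g xs) <= f y + fine (g y).
  by move=> gy; have := hmin y; rewrite !hE// lee_fin.
have mG y j : has_mean P (fun i => grad (fi i) y 0 j) (grad f y 0 j) := gmean y j.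
have [s2 ms2 s20] : exists2 m : R, has_mean P (fun i => sqnorm (grad (fi i) xs)) m & 0 <= m.
  apply: has_mean_sqnorm => // j; have [/integrableP[+ _] _] := mG xs j.
  by move=> mf; apply/measurable_EFinP; exact: mf.
rewrite /sigma2 ms2.2.
have fgrad i x y : fi i x + dot (grad (fi i) x) (y - x) <= fi i y.
  exact: grad_le.
have fdesc i x y :
    fi i y <= fi i x + dot (grad (fi i) x) (y - x) + L / 2 * sqnorm (y - x).
  by apply: descent_lemma => //; exact: ltW.
have fcoco i := cocoercive (fi i) (fdf i) (fcv i) L L0 (flip i).
(* If [g x0] is infinite, so is the right-hand side. *)
have [gx0|gx0] := boolP (g x0 \is a fin_num); last first.
  have -> : h x0 = +oo%E.
    move: gx0; rewrite fin_numE gp.1 negbK /= => /eqP gx0.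
    by rewrite /h gx0 addey.
  rewrite /hstar hE// -EFinN addye// gt0_muley ?lte_fin ?invr_gt0//.
  rewrite addey// -EFinM addye// gt0_muley ?leey// lte_fin divr_gt0//.
have Xfin s : g (X s) \is a fin_num.
  by apply: (g_X (fun i => grad (fi i)) g tau gp tau0 X Xst); rewrite X0.
have -> : (fun s => h (X s) - hstar)%E = (fun s => (gap f g xs (X ([::] ++ s)))%:E).
  by apply/funext => s; rewrite gapE.
rewrite gapE// -!EFinM.
set K := (Num.sqrt T%:R)^-1 * gap f g xs x0 + s2 * (L^-1 * (T%:R^-1 + 4 * ln T.+1%:R)).
(* Each minimizer [y] serves as initial reference point, while the noise is measured at the fixed
   [xs]; [gap y = 0] removes one term. *)
have bound y : argmin_set h y ->
  (Eiter P T.+1 (fun s => (gap f g xs (X ([::] ++ s)))%:E)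
   <= (9 / Num.sqrt T%:R * (L * sqnorm (y - x0) + K))%:E)%E.
  move=> hy; have gy := argmin_fin _ hy.
  have gap_y : gap f g xs y = 0.
    apply/eqP; rewrite subr_eq0 eq_le xs_min// andbT.
    by have := hy xs; rewrite !hE// lee_fin.
  have gX0 : g (X [::]) \is a fin_num by rewrite X0.
  apply: le_trans (Eiter_gap_le P fi f (fun i => grad (fi i)) (grad f) g L tau s2 xs
    L0 fgrad fdesc fcoco fmean mG gp gc gxs xs_min ms2 tau0 tauL X Xst gX0 T.+1 [::] y gy) _.
  rewrite lee_fin gap_y mulr0 addr0 X0 sqnormBC /K addrA.
  by apply: last_gap_bound => //; [exact: sqnorm_ge0 | rewrite subr_ge0 xs_min].
have Efin : Eiter P T.+1 (fun s => (gap f g xs (X ([::] ++ s)))%:E) \is a fin_num.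
  rewrite ge0_fin_numE; first exact: le_lt_trans (bound _ hmin) (ltry _).
  by apply: Eiter_ge0 => s; rewrite lee_fin subr_ge0 xs_min.
rewrite -addrA -/K.
rewrite -(fineK Efin) lee_fin; move: bound; rewrite -(fineK Efin).
move: (fine _) => e bound.
(* Solved for [r], the bounds say that one number lies below every squared distance from [x0] to a
   minimizer, hence below the infimum. *)
have solve_r r : (e <= 9 / Num.sqrt T%:R * (L * r + K)) =
    ((e * Num.sqrt T%:R / 9 - K) / L <= r).
  rewrite ler_pdivrMr// lerBlDr ler_pdivrMr// [9 / _ * _]mulrAC ler_pdivlMr//.
  by rewrite [9 * _]mulrC [L * r]mulrC.
rewrite solve_r; apply: lb_le_inf; first by exists (sqnorm (xs - x0)), xs.
by move=> _ [y hy <-]; rewrite -solve_r -lee_fin; exact: bound.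
Qed.
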